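(* Let $0<r<q<1$ and suppose $r^j=q^m$, where $j$ and $m$ are mutually prime positive integers. Then $$\|B_q-B_r\|\geqslant\frac{2(m-1)}{m}.$$
   Context: For $q\in(0,1)$ and $a\in\mathbb{C}$, write $(a;q)_0:=1$, $(a;q)_k:=\prod_{s=0}^{k-1}(1-aq^s)$ for $k\geqslant 1$, and $(a;q)_\infty:=\prod_{s=0}^{\infty}(1-aq^s)$. For $q\in(0,1)$, $k\in\mathbb{N}_0=\{0,1,2,\dots\}$, $x\in[0,1]$ put $$p_k(q;x):=\frac{x^k\,(x;q)_\infty}{(q;q)_k}$$ (with $x^0=1$). For $q\in(0,1)$ the limit $q$-Bernstein operator $B_q:C[0,1]\to C[0,1]$, $f\mapsto B_qf$, is the bounded linear operator given by $$B_q(f;x)=\sum_{k=0}^{\infty}f(1-q^k)\,p_k(q;x)\ \text{ for } x\in[0,1),\qquad B_q(f;1)=f(1).$$ Here $C[0,1]$ is the space of continuous functions on $[0,1]$ with the supremum norm, and $\|\cdot\|$ applied to operators is the operator norm on $C[0,1]$. *)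

(* Defs.v *)
From mathcomp Require Import all_boot all_order all_algebra.
From mathcomp Require Import all_classical all_reals all_analysis.
Import Order.TTheory GRing.Theory Num.Theory.
Import numFieldNormedType.Exports.

Set Implicit Arguments.
Unset Strict Implicit.
Unset Printing Implicit Defensive.

Local Open Scope classical_set_scope.
Local Open Scope ring_scope.

Section LimitQBernstein.
Context {R : realType}.
Implicit Types (a q x : R) (f : R -> R).

Definition qpoch a q (k : nat) : R := \prod_(s < k) (1 - a * q ^+ s).

Definition qpoch_inf a q : R := limn (qpoch a q).

Definition qbasis (k : nat) q x : R :=
  x ^+ k * qpoch_inf x q / qpoch q q k.

(* Only the values of [f] on [0, 1] are used when [0 < q < 1] and
   [0 <= x <= 1]; the values for [x] outside [0, 1] are irrelevant. *)
Definition limit_qbernstein q f : R -> R := fun x =>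
  if x == 1 then f 1
  else limn (series (fun k => f (1 - q ^+ k) * qbasis k q x)).

(* An element of C[0,1] is represented by any function on [R] whose
   restriction to [0, 1] is continuous. *)
Definition C01 : set (R -> R) := [set f : R -> R | {within `[0, 1], continuous f}].

(* The two norms are extended reals, so that the suprema have no default
   value. *)
Definition sup_norm f : \bar R :=
  ereal_sup [set `|f x|%:E | x in `[0, 1]].

Definition op_norm (T : (R -> R) -> (R -> R)) : \bar R :=
  ereal_sup [set sup_norm (T f) | f in [set f | C01 f /\ (sup_norm f <= 1)%E]].

End LimitQBernstein.

(* Main.v *)
(** The common root t with q = t ^+ j and r = t ^+ m puts the nodes of both
    operators among the points 1 - t ^+ n, and by coprimality 1 - q ^+ k is a
    node of B_r only if m divides k. So there is a continuous f with values in
    [-1, 1] equal to 1 at the points 1 - q ^+ k with k < n and m not dividing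
    k, and to -1 at all other nodes. By Euler's identity the basis functions
    sum to 1, hence B_r f = -1 on ]0, 1[ and B_q f - B_r f is twice the sum T of
    the p_k(q; x) with k < n and m not dividing k. Since 1 / (q;q)_k increases
    with k, p_(k+i)(q; x) >= x ^+ i * p_k(q; x), which for n -> oo bounds T from
    below by (m - 1) x ^+ m / (1 + (m - 1) x ^+ m); now let x tend to 1. *)

Require Import Defs.
From mathcomp Require Import all_boot all_order all_algebra.
From mathcomp Require Import all_classical all_reals all_analysis.
From mathcomp Require Import ring lra.
Import Order.TTheory GRing.Theory Num.Theory.
Import numFieldNormedType.Exports.

Local Open Scope ring_scope.

(** * Euler's series for 1 / (x;q)_oo and the limit q-Bernstein basis *)

Section EulerSeries.
Context {R : realType}.
Implicit Types (q x y : R).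

Lemma qpochS x q k : qpoch x q k.+1 = qpoch x q k * (1 - x * q ^+ k).
Proof. by rewrite /qpoch big_ord_recr. Qed.

Lemma qpoch_gt0 x q k : 0 < q < 1 -> 0 < x < 1 -> 0 < qpoch x q k.
Proof.
move=> /andP[q0 q1] /andP[x0 x1]; apply: prodr_gt0 => i _.
rewrite subr_gt0; apply: le_lt_trans x1.
by rewrite ler_piMr ?exprn_ile1 ?ltW.
Qed.

(** Euler's series: for q and x in ]0, 1[ its sum turns out to be 1 / (x;q)_oo. *)
Definition euler_term q x : R^nat := fun k => x ^+ k / qpoch q q k.

Lemma euler_term0 q x : euler_term q x 0%N = 1.
Proof. by rewrite /euler_term expr0 /qpoch big_ord0 divr1. Qed.

Lemma euler_term_ge0 q x k : 0 < q < 1 -> 0 <= x -> 0 <= euler_term q x k.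
Proof. by move=> q01 x0; rewrite divr_ge0 ?exprn_ge0 // ltW // qpoch_gt0. Qed.

Lemma nondecreasing_euler_series q x :
  0 < q < 1 -> 0 <= x -> nondecreasing_seq (series (euler_term q x)).
Proof.
by move=> q01 x0; apply/nondecreasing_seqP => n; rewrite seriesSr lerDl euler_term_ge0.
Qed.

(** Finite form of the functional equation F(xq) = (1 - x) F(x), which generates the factors of
    (x;q)_oo. Stated on partial sums, it can be used before convergence is known. *)
Lemma euler_series_shift q x n : 0 < q < 1 ->
  series (euler_term q (x * q)) n.+1
  = series (euler_term q x) n.+1 - x * series (euler_term q x) n.
Proof.
move=> q01; elim: n => [|n IH].
  by rewrite !seriesSr !euler_term0 /series /= !big_geq // mulr0 subr0.
rewrite seriesSr IH (seriesSr _ n.+1) [in X in _ = _ - X](seriesSr _ n).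
(* Write [q ^+ n.+1] as 1 - (1 - [q ^+ n.+1]) and cancel the last factor of [qpoch q q n.+1]. *)
have : euler_term q (x * q) n.+1 = euler_term q x n.+1 - x * euler_term q x n.
  have := qpoch_gt0 q q n q01 q01; have := qpoch_gt0 q q n.+1 q01 q01.
  rewrite /euler_term qpochS exprMn !exprS => /lt0r_neq0; rewrite mulf_eq0 negb_or.
  by move=> /andP[h1 h2] _; field; rewrite h1 h2.
move=> ->; ring.
Qed.

Lemma euler_series_le_shift q x n : 0 < q < 1 -> 0 <= x ->
  (1 - x) * series (euler_term q x) n <= series (euler_term q (x * q)) n.
Proof.
move=> q01 x0; case: n => [|n]; first by rewrite /series /= !big_geq // mulr0.
rewrite euler_series_shift // mulrBl mul1r lerB // ler_wpM2l //.
exact: nondecreasing_euler_series.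
Qed.

(** Carries a bound at the small point [x * q ^+ k] back to [x]; the geometric bound below only
    reaches arguments under 1 - q. *)
Lemma euler_series_le_shiftn q x n k : 0 < q < 1 -> 0 <= x < 1 ->
  qpoch x q k * series (euler_term q x) n <= series (euler_term q (x * q ^+ k)) n.
Proof.
move=> q01 /andP[x0 x1]; have /andP[q0 q1] := q01; elim: k => [|k IH].
  by rewrite /qpoch big_ord0 mul1r expr0 mulr1.
have xq0 : 0 <= x * q ^+ k by rewrite mulr_ge0 // exprn_ge0 // ltW.
have xq1 : x * q ^+ k <= 1 by rewrite mulr_ile1 // ?exprn_ge0 ?exprn_ile1 ?ltW.
rewrite qpochS mulrAC mulrC exprSr mulrA.
apply: le_trans (euler_series_le_shift _ _ _ q01 xq0).
by rewrite ler_wpM2l // subr_ge0.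
Qed.

(* Each factor of (q;q)_k is at least 1 - q, so the series is dominated by a
   geometric one. *)
Lemma euler_series_ub q y n : 0 < q < 1 -> 0 < y < 1 - q ->
  series (euler_term q y) n <= (1 - y / (1 - q))^-1.
Proof.
move=> q01 /andP[y0 yq]; have /andP[q0 q1] := q01.
have p0 : 0 < 1 - q by rewrite subr_gt0.
have z0 : 0 < y / (1 - q) by rewrite divr_gt0.
have z1 : y / (1 - q) < 1 by rewrite ltr_pdivrMr // mul1r.
apply: (@le_trans _ _ (series (geometric 1 (y / (1 - q))) n)).
  apply: ler_sum => k _; rewrite /= /euler_term mul1r expr_div_n.
  rewrite ler_wpM2l ?exprn_ge0 ?(ltW y0) // lef_pV2 ?posrE ?exprn_gt0 ?qpoch_gt0 //.
  rewrite /qpoch -[X in _ ^+ X]card_ord -prodr_const; apply: ler_prod => i _.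
  by rewrite ltW //= lerB // ler_piMr ?exprn_ile1 // ltW.
rewrite -[X in _ <= X]mul1r; apply: geometric_le_lim => //.
by rewrite gtr0_norm.
Qed.

Lemma cvg_mul_expr x q : 0 < q < 1 -> (x * q ^+ k @[k --> \oo] --> (0 : R))%classic.
Proof.
move=> /andP[q0 q1]; rewrite -[X in (_ --> X)%classic](mulr0 x).
by apply: cvgMr; apply: cvg_expr; rewrite gtr0_norm.
Qed.

Lemma is_cvg_euler_series q x : 0 < q < 1 -> 0 < x < 1 ->
  cvgn (series (euler_term q x)).
Proof.
move=> q01 x01; have /andP[q0 q1] := q01; have /andP[x0 x1] := x01.
apply: nondecreasing_is_cvgn; first by apply: nondecreasing_euler_series => //; exact: ltW.
have [k xk] : exists k, x * q ^+ k < 1 - q.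
  have /cvgr_lt/(_ (1 - q)) := cvg_mul_expr x q q01.
  by rewrite subr_gt0 => /(_ q1)[k _ /(_ k (leqnn _))]; exists k.
(* The geometric bound at [x * q ^+ k], divided by the factor lost in shifting from [x]. *)
exists ((1 - x * q ^+ k / (1 - q))^-1 / qpoch x q k) => _ [n _ <-].
rewrite ler_pdivlMr ?qpoch_gt0 // mulrC.
apply: le_trans (euler_series_le_shiftn q x n k q01 _) _; first by rewrite ltW.
by apply: euler_series_ub => //; rewrite mulr_gt0 // exprn_gt0.
Qed.

Definition euler_sum q x : R := limn (series (euler_term q x)).

Lemma euler_sum_ge1 q x : 0 < q < 1 -> 0 < x < 1 -> 1 <= euler_sum q x.
Proof.
move=> q01 x01; have /andP[x0 _] := x01.
have := nondecreasing_cvgn_le (nondecreasing_euler_series q x q01 (ltW x0))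
          (is_cvg_euler_series q x q01 x01) 1%N.
by rewrite seriesSr euler_term0 /series /= big_geq // add0r.
Qed.

(** Together with [euler_sum_ge1], this forces [euler_sum q y] to 1 as y decreases to 0. *)
Lemma euler_sum_ub q y : 0 < q < 1 -> 0 < y < 1 - q ->
  euler_sum q y <= (1 - y / (1 - q))^-1.
Proof.
move=> q01 y01; have /andP[q0 q1] := q01.
apply: limr_le; first by apply: is_cvg_euler_series => //; lra.
by apply: nearW => n; apply: euler_series_ub.
Qed.

Lemma euler_sum_shift q x : 0 < q < 1 -> 0 < x < 1 ->
  euler_sum q (x * q) = (1 - x) * euler_sum q x.
Proof.
move=> q01 x01; have /andP[q0 q1] := q01.
have cx := is_cvg_euler_series q x q01 x01.
have cxq : cvgn (series (euler_term q (x * q))).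
  by apply: is_cvg_euler_series => //; nra.
rewrite mulrBl mul1r; apply: cvg_lim => //; rewrite -cvg_shiftS /=.
under eq_fun do rewrite euler_series_shift //.
apply: cvgB; first by rewrite (cvg_shiftS (series (euler_term q x))).
exact: cvgMr.
Qed.

Lemma euler_sum_shiftn q x n : 0 < q < 1 -> 0 < x < 1 ->
  euler_sum q (x * q ^+ n) = qpoch x q n * euler_sum q x.
Proof.
move=> q01 x01; have /andP[q0 q1] := q01; have /andP[x0 x1] := x01.
elim: n => [|n IH]; first by rewrite expr0 mulr1 /qpoch big_ord0 mul1r.
rewrite exprSr mulrA euler_sum_shift // ?IH ?qpochS; first by ring.
rewrite mulr_gt0 ?exprn_gt0 //=; apply: le_lt_trans x1.
by rewrite ler_piMr ?exprn_ile1 ?ltW.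
Qed.

(** The shift equation makes [qpoch x q n] the ratio of [euler_sum] at [x * q ^+ n] and at [x]; the
    numerator tends to 1 by squeezing. *)
Lemma cvg_qpoch q x : 0 < q < 1 -> 0 < x < 1 ->
  (qpoch x q n @[n --> \oo] --> (euler_sum q x)^-1)%classic.
Proof.
move=> q01 x01; have /andP[q0 q1] := q01; have /andP[x0 x1] := x01.
have F0 : euler_sum q x != 0.
  by rewrite gt_eqF // (lt_le_trans ltr01) // euler_sum_ge1.
have -> : qpoch x q = fun n => euler_sum q (x * q ^+ n) * (euler_sum q x)^-1.
  by apply/funext => n; rewrite euler_sum_shiftn // mulfK.
rewrite -[X in (_ --> X)%classic]mul1r; apply: cvgMl.
apply: (@squeeze_cvgr _ _ _ _ (fun=> 1) (fun n => (1 - x * q ^+ n / (1 - q))^-1)).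
- have /cvgr_lt/(_ (1 - q)) := cvg_mul_expr x q q01.
  rewrite subr_gt0 => /(_ q1); apply: filterS => n xn.
  have xn0 : 0 < x * q ^+ n by rewrite mulr_gt0 ?exprn_gt0.
  rewrite euler_sum_ge1 ?euler_sum_ub ?xn0 //=; lra.
- exact: cvg_cst.
- rewrite -[X in (_ --> X)%classic]invr1; apply: cvgV; first exact: oner_neq0.
  rewrite -[X in (_ --> X)%classic]subr0; apply: cvgB; first exact: cvg_cst.
  rewrite -[X in (_ --> X)%classic](mul0r (1 - q)^-1); apply: cvgMl.
  exact: cvg_mul_expr.
Qed.

Lemma qpoch_infE q x : 0 < q < 1 -> 0 < x < 1 ->
  qpoch_inf x q = (euler_sum q x)^-1.
Proof. by move=> q01 x01; apply: cvg_lim => //; apply: cvg_qpoch. Qed.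

Lemma qbasisE q x k : qbasis k q x = qpoch_inf x q * euler_term q x k.
Proof. by rewrite /qbasis /euler_term mulrCA mulrA. Qed.

Lemma cvg_series_qbasis q x : 0 < q < 1 -> 0 < x < 1 ->
  (series (fun k => qbasis k q x) n @[n --> \oo] --> (1 : R))%classic.
Proof.
move=> q01 x01.
have F0 : euler_sum q x != 0.
  by rewrite gt_eqF // (lt_le_trans ltr01) // euler_sum_ge1.
have -> : series (fun k => qbasis k q x)
    = fun n => (euler_sum q x)^-1 * series (euler_term q x) n.
  apply/funext => n; rewrite /series /= mulr_sumr; apply: eq_bigr => k _.
  by rewrite qbasisE qpoch_infE.
rewrite -(mulVf F0); apply: cvgMr; exact: is_cvg_euler_series.
Qed.

Lemma qbasis_ge0 q x k : 0 < q < 1 -> 0 < x < 1 -> 0 <= qbasis k q x.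
Proof.
move=> q01 x01; have /andP[x0 _] := x01.
rewrite qbasisE qpoch_infE // mulr_ge0 ?euler_term_ge0 ?ltW //.
by rewrite invr_gt0 (lt_le_trans ltr01) // euler_sum_ge1.
Qed.

(** Passing from index n to n + 1 multiplies the basis function by x / (1 - [q ^+ n.+1]), which is
    at least x. *)
Lemma qbasis_addn_ge q x k i : 0 < q < 1 -> 0 < x < 1 ->
  x ^+ i * qbasis k q x <= qbasis (k + i) q x.
Proof.
move=> q01 x01; have /andP[x0 x1] := x01; elim: i => [|i IH].
  by rewrite expr0 mul1r addn0.
rewrite exprS -mulrA addnS; apply: le_trans (ler_wpM2l (ltW x0) IH) _.
move: (k + i)%N => n; rewrite /qbasis exprS -!mulrA ler_wpM2l ?(ltW x0) //.
rewrite ler_wpM2l ?exprn_ge0 ?(ltW x0) // ler_wpM2l //.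
  by rewrite qpoch_infE // invr_ge0 (le_trans ler01) // euler_sum_ge1.
rewrite lef_pV2 ?posrE ?qpoch_gt0 // qpochS.
have /andP[q0 q1] := q01.
by rewrite ler_piMr ?gerBl ?mulr_ge0 ?exprn_ge0 ?ltW // qpoch_gt0.
Qed.

End EulerSeries.

(** * Basis functions off the multiples of m, test functions on the nodes, and the common root *)

Section OffMultiples.
Context {R : realType}.
Implicit Types (q r x t : R) (f : R -> R).

(** Multiples of m are zeroed rather than skipped, so that partial sums can be compared with those
    of [qbasis] block by block. *)
Definition qbasis_off (m : nat) q x : R^nat :=
  fun k => if (m %| k)%N then 0 else qbasis k q x.

Lemma series_addn (u : R^nat) a b :
  series u (a + b)%N = series u a + \sum_(0 <= i < b) u (a + i)%N.
Proof.
rewrite /series /= (@big_cat_nat _ _ _ a) ?leq_addr //=; congr (_ + _).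
by rewrite -{1}[a]add0n big_addn addKn; apply: eq_bigr => i _; rewrite addnC.
Qed.

(* In every block of m consecutive indices the m - 1 terms following the
   multiple of m are at least x ^ m times the term at that multiple. *)
Lemma series_qbasis_off_ge q x m n : 0 < q < 1 -> 0 < x < 1 ->
  m%:R * x ^+ m.+1 * series (fun k => qbasis k q x) (n * m.+1)%N
  <= (1 + m%:R * x ^+ m.+1) * series (qbasis_off m.+1 q x) (n * m.+1)%N.
Proof.
move=> q01 x01; have /andP[x0 x1] := x01; elim: n => [|n IH].
  by rewrite mul0n /series /= !big_geq // !mulr0.
rewrite mulSn addnC !series_addn !mulrDr; apply: lerD IH _.
rewrite !big_nat_recl //= addn0 [qbasis_off _ _ _ (n * m.+1)%N]/qbasis_off dvdn_mull // add0r.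
set k := (n * m.+1)%N; set d := \sum_(0 <= i < m) qbasis (k + i.+1) q x.
have -> : \sum_(0 <= i < m) qbasis_off m.+1 q x (k + i.+1)%N = d.
  apply: eq_big_nat => i /andP[_ im]; rewrite /qbasis_off dvdn_addr ?dvdn_mull //.
  by rewrite gtnNdvd.
suff : m%:R * x ^+ m.+1 * qbasis k q x <= d by lra.
rewrite -mulrA mulr_natl -[X in _ *+ X]subn0 -sumr_const_nat.
apply: ler_sum_nat => i /andP[_ im].
apply: le_trans (qbasis_addn_ge _ _ _ _ q01 x01).
by rewrite ler_wpM2r ?qbasis_ge0 // ler_wiXn2l ?(ltW x0) ?(ltW x1) // ltnS ltnW.
Qed.

(** The constant [c] comes out unchanged because the basis functions sum to 1; what remains is a
    finite sum. *)
Lemma limit_qbernstein_eventually_cst q x f (c : R) (g : R^nat) n :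
  0 < q < 1 -> 0 < x < 1 -> (forall k, (n <= k)%N -> g k = 0) ->
  (forall k, f (1 - q ^+ k) = c + g k) ->
  limit_qbernstein q f x = c + \sum_(0 <= k < n) g k * qbasis k q x.
Proof.
move=> q01 x01 g0 fE; have /andP[_ x1] := x01.
rewrite /limit_qbernstein lt_eqF //; apply: cvg_lim => //.
have -> : series (fun k => f (1 - q ^+ k) * qbasis k q x)
    = fun i => c * series (fun k => qbasis k q x) i
               + series (fun k => g k * qbasis k q x) i.
  apply/funext => i; rewrite /series /= mulr_sumr -big_split /=.
  by apply: eq_bigr => k _; rewrite fE mulrDl.
apply: cvgD.
  by rewrite -[X in (_ --> X)%classic]mulr1; apply: cvgMr; apply: cvg_series_qbasis.
apply: cvg_near_cst; exists n => // i /= ni.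
rewrite -(subnKC ni) series_addn [X in _ + X]big1 ?addr0 // => k _.
by rewrite g0 ?leq_addr // mul0r.
Qed.

(** The next power after [t ^+ a] is already [t ^+ a * (1 - t)] away. The bound is uniform in b, so
    it covers the infinitely many powers beyond M. *)
Lemma expr_separated t M a b : 0 < t < 1 -> (a < b)%N -> (a <= M)%N ->
  t ^+ M * (1 - t) <= t ^+ a - t ^+ b.
Proof.
move=> /andP[t0 t1] ab aM; have [t0' t1'] := (ltW t0, ltW t1).
apply: (@le_trans _ _ (t ^+ a * (1 - t))).
  by rewrite ler_wpM2r ?subr_ge0 // ler_wiXn2l.
by rewrite mulrBr mulr1 -exprSr lerB // ler_wiXn2l.
Qed.

Lemma exists_continuous_sign t M (P : pred nat) : 0 < t < 1 ->
  exists f : R -> R, [/\ continuous f, (forall y, `|f y| <= 1)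
    & forall n, f (1 - t ^+ n) = if (n < M)%N && P n then 1 else -1].
Proof.
move=> t01; have /andP[t0 t1] := t01.
set d := t ^+ M * (1 - t).
have d0 : 0 < d by rewrite mulr_gt0 ?exprn_gt0 // subr_gt0.
(* Truncated distance to node n: it is 0 there and, for n < M, equals 1 at every other node, since
   these are at least [d] away. *)
pose g (n : nat) y : R := Num.min 1 (`|y - (1 - t ^+ n)| / d).
have g01 n y : 0 <= g n y <= 1.
  by rewrite /g le_min ge_min lexx ler01 divr_ge0 // ltW.
have gsep n i : (n < M)%N -> n != i -> g n (1 - t ^+ i) = 1.
  move=> nM ni; apply/min_idPl; rewrite ler_pdivlMr // mul1r.
  have -> : 1 - t ^+ i - (1 - t ^+ n) = t ^+ n - t ^+ i by ring.
  move: ni; rewrite neq_ltn => /orP[ni|ni].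
    by apply: le_trans (ler_norm _); apply: expr_separated => //; exact: ltnW.
  rewrite distrC; apply: le_trans (ler_norm _); apply: expr_separated => //.
  by rewrite ltnW // (ltn_trans ni).
(* The product lies in [0, 1], vanishes at the selected nodes and is 1 at the others. *)
exists (fun y => 1 - 2 * \prod_(n < M | P n) g n y); split.
- move=> y; apply: cvgB; first exact: cvg_cst.
  apply: cvgMr; apply: cvg_big; first exact: mul_continuous.
  move=> n _; apply: (@continuous_min R R (fun=> 1) (fun y => `|y - (1 - t ^+ n)| / d)); first exact: cvg_cst.
  apply: cvgMl; apply: cvg_norm; apply: cvgB; [exact: cvg_id | exact: cvg_cst].
- move=> y; have : 0 <= \prod_(n < M | P n) g n y by apply: prodr_ge0 => n _; case/andP: (g01 n y).
  have : \prod_(n < M | P n) g n y <= 1 by apply: prodr_ile1 => n _; exact: g01.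
  by rewrite ler_norml => h1 h2; apply/andP; split; lra.
- move=> i; case: ifPn => [/andP[iM Pi]|niMP].
    rewrite (bigD1 (Ordinal iM)) //= [g i _]/g subrr normr0 mul0r min_r //.
    by rewrite mul0r mulr0 subr0.
  rewrite big1 => [|n Pn]; first by rewrite mulr1; ring.
  apply: gsep => //; apply: contraNneq niMP => <-; by rewrite ltn_ord.
Qed.

(** With t the j-th root of q, the positive numbers r and [t ^+ m] have the same j-th power
    [q ^+ m]. *)
Lemma exists_common_root q r j m : 0 < r -> 0 < q < 1 -> (0 < j)%N ->
  r ^+ j = q ^+ m -> exists2 t : R, 0 < t < 1 & q = t ^+ j /\ r = t ^+ m.
Proof.
move=> r0 /andP[q0 q1] j0 rq; pose t := q `^ (j%:R^-1).
have t0 : 0 < t by exact: powR_gt0.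
have tj : t ^+ j = q.
  by rewrite -powR_mulrn ?ltW // -powRrM mulVf ?pnatr_eq0 -?lt0n // powRr1 // ltW.
exists t; last split => //.
  by rewrite t0 /= -(expr_lt1 j0 (ltW t0)) tj.
apply: (pexpIrn j0); rewrite ?nnegrE ?exprn_ge0 ?ltW //.
by rewrite rq -tj -!exprM mulnC.
Qed.

End OffMultiples.

(** * Lower bounds for the operator norm *)

Section OperatorNorm.
Context {R : realType}.
Implicit Types (q r x : R) (f : R -> R).

Lemma op_norm_ge (T : (R -> R) -> R -> R) f x : continuous f ->
  (forall y, `|f y| <= 1) -> 0 <= x <= 1 -> (`|T f x|%:E <= op_norm T)%E.
Proof.
move=> fc f1 x01; apply: (@le_trans _ _ (sup_norm (T f))).
  by apply: ereal_sup_ubound; exists x => //=; rewrite in_itv.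
apply: ereal_sup_ubound; exists f => //; split.
  exact: continuous_subspaceT.
by apply: ge_ereal_sup => _ [y _ <-]; rewrite lee_fin.
Qed.

Lemma op_norm_limit_qbernstein_ge q r j m n x :
  0 < r < 1 -> 0 < q < 1 -> (0 < j)%N -> (0 < m)%N -> coprime j m ->
  r ^+ j = q ^+ m -> 0 < x < 1 ->
  ((2 * series (qbasis_off m q x) n)%:E
     <= op_norm (limit_qbernstein q - limit_qbernstein r)%R)%E.
Proof.
move=> r01 q01 j0 m0 jm rq x01; have /andP[x0 x1] := x01.
have /andP[r0 _] := r01.
have [t t01 [qE rE]] := exists_common_root _ _ _ _ r0 q01 j0 rq.
(* Here [k] is an exponent of t: since [q ^+ i] is [t ^+ (j * i)], the predicate picks the nodes of
   B_q with m not dividing i, and the cutoff [j * n] on exponents means i < n. *)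
pose P k := (j %| k)%N && ~~ (m * j %| k)%N.
have [f [fc f1 fE]] := exists_continuous_sign t (j * n) P t01.
have Bq : limit_qbernstein q f x = -1 + 2 * series (qbasis_off m q x) n.
  pose g k : R := if (k < n)%N && ~~ (m %| k)%N then 2 else 0.
  rewrite (limit_qbernstein_eventually_cst q x f (-1) g n q01 x01).
  - rewrite /series /= mulr_sumr; congr (_ + _); apply: eq_big_nat => k /andP[_ kn].
    by rewrite /g /qbasis_off kn /=; case: (m %| k)%N; rewrite /= ?mulr0 ?mul0r.
  - by move=> k nk; rewrite /g ltnNge nk.
  move=> k; rewrite {1}qE -exprM fE /P ltn_pmul2l // dvdn_mulr //=.
  rewrite mulnC dvdn_pmul2l // /g; case: ifP => _; ring.
have Br : limit_qbernstein r f x = -1.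
  rewrite (limit_qbernstein_eventually_cst r x f (-1) (fun=> 0) 0 r01 x01) //.
    by rewrite big_geq // addr0.
  (* By coprimality, j divides m k only if j divides k, and then m j divides m k: [P] fails at every
     node of B_r. *)
  move=> k; rewrite {1}rE -exprM fE addr0 /P Gauss_dvdr //.
  by rewrite dvdn_pmul2l // andbN andbF.
apply: le_trans (op_norm_ge _ f x fc f1 _); last by rewrite !ltW.
rewrite lee_fin; apply: le_trans (ler_norm _).
rewrite !fctE Bq Br; lra.
Qed.

End OperatorNorm.

Theorem theorem1p5 (R : realType) (q r : R) (j m : nat)
    (r_gt0 : 0 < r) (ltrq : r < q) (q_lt1 : q < 1)
    (j_gt0 : (0 < j)%N) (m_gt0 : (0 < m)%N) (coprime_jm : coprime j m)
    (rjqm : r ^+ j = q ^+ m) :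
  ((2 * (m%:R - 1) / m%:R)%:E
     <= op_norm (limit_qbernstein q - limit_qbernstein r)%R)%E.
Proof.
have r01 : 0 < r < 1 by rewrite r_gt0 (lt_trans ltrq).
have q01 : 0 < q < 1 by rewrite q_lt1 (lt_trans r_gt0).
have lbx n x := op_norm_limit_qbernstein_ge
  q r j m n x r01 q01 j_gt0 m_gt0 coprime_jm rjqm.
(* The point 1/2 only serves to exclude the value -oo of the norm; for +oo the claim is trivial. *)
have h2 : 0 < (2^-1 : R) < 1 by apply/andP; split; lra.
move: lbx (lbx 0%N _ h2); case: (op_norm _) => [s||] lbx; rewrite ?leey ?leeNy_eq // => _.
(* From here on [m] is the predecessor of the original m, so the target is 2 m / (m + 1). *)
rewrite lee_fin; case: m m_gt0 coprime_jm rjqm lbx => // m _ _ _ lbx.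
(* The limit n -> oo at fixed x, with the denominator cleared. *)
have key x : 0 < x < 1 -> 2 * (m%:R * x ^+ m.+1) <= (1 + m%:R * x ^+ m.+1) * s.
  move=> x01; have /andP[x0 _] := x01.
  set a := m%:R * x ^+ m.+1; have a0 : 0 <= a by rewrite mulr_ge0 // exprn_ge0 // ltW.
  have : (2 * a * series (fun k => qbasis k q x) n @[n --> \oo] --> 2 * a * 1)%classic.
    by apply: cvgMr; exact: cvg_series_qbasis.
  rewrite mulr1 => /cvgr_to_le; apply; apply: nearW => n.
  (* Monotonicity replaces n by a whole number of blocks, where the block estimate applies. *)
  apply: (@le_trans _ _ (2 * (a * series (fun k => qbasis k q x) (n * m.+1)%N))).
    rewrite -mulrA !ler_wpM2l //.
    have nd : nondecreasing_seq (series (fun k => qbasis k q x)).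
      by apply/nondecreasing_seqP => i; rewrite seriesSr lerDl qbasis_ge0.
    by apply: nd; rewrite leq_pmulr.
  apply: (@le_trans _ _ (2 * ((1 + a) * series (qbasis_off m.+1 q x) (n * m.+1)%N))).
    by rewrite ler_wpM2l // series_qbasis_off_ge.
  rewrite mulrCA ler_wpM2l //; first by rewrite addr_ge0.
  by have := lbx (n * m.+1)%N x x01; rewrite lee_fin.
(* [key] is available only for x < 1; a left limit extends it to x = 1. *)
have : ((1 + m%:R * x ^+ m.+1) * s - 2 * (m%:R * x ^+ m.+1) @[x --> (1 : R)^'-]
    --> (1 + m%:R * 1 ^+ m.+1) * s - 2 * (m%:R * 1 ^+ m.+1))%classic.
  apply: (@cvg_at_left_filter R R).
  have cX : (m%:R * x ^+ m.+1 @[x --> (1 : R)] --> (m%:R * 1 ^+ m.+1 : R))%classic.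
    by apply: cvgMr; exact: exprn_continuous.
  by apply: cvgB; [apply: cvgMl; apply: cvgD => //; exact: cvg_cst | exact: cvgMr].
rewrite expr1n mulr1 => /cvgr_to_ge lim_ge; rewrite ler_pdivrMr // -(natr1 m).
suff : 0 <= (1 + m%:R) * s - 2 * m%:R by lra.
apply: lim_ge; near=> x; rewrite subr_ge0; apply: key.
  apply/andP; split; last by near: x; exact: nbhs_left_lt.
  by near: x; exact: nbhs_left_gt.
Unshelve. all: by end_near.
Qed.
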